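(* Let $\mathcal{G}_1(\mathbb{R}_{++})$ be the set of cumulative distribution functions of Borel probability measures on $\mathbb{R}$ supported in $\mathbb{R}_{++}$ (i.e. right-continuous non-decreasing $F:[0,\infty]\to[0,1]$ with $F(0)=0$, $F(\infty)=1$). Then \[ R_2=\inf_{F\in\mathcal{G}_1(\mathbb{R}_{++})}\ \sup_{x,y\in\mathbb{R}_{++}}\Big(1+y-\min\{1,1-\tfrac1x+y\}F(x)-yF(y)+\min\{1+\tfrac1x,1+y\}\max\{0,F(x)+F(y)-1\}\Big). \]
   Context: Scheduling on two machines with two tasks. A processing-time matrix is $T=(T_{ij})\in\mathbb{R}_{++}^{2\times 2}$. An allocation is $X\in\{0,1\}^{2\times2}$ with $X_{1j}+X_{2j}=1$; makespan $M(X,T)=\max_{i}\sum_j X_{ij}T_{ij}$; $M^*(T)=\min_X M(X,T)$. $\mathcal{P}_2$ is the set of Borel probability measures on $\mathbb{R}^2$ supported in $\mathbb{R}_{++}^2$. For $\mathbb{P}\in\mathcal{P}_2$, algorithm $\mathcal{A}^{\mathbb{P}}$ draws $(z_1,z_2)\sim\mathbb{P}$ and sends task $j$ to machine 1 iff $T_{1j}/T_{2j}<z_j$ (else to machine 2). $M(\mathbb{P},T)$ is the expected makespan, $R_2(\mathbb{P})=\sup_T M(\mathbb{P},T)/M^*(T)\in[1,\infty]$, and $R_2=\inf_{\mathbb{P}\in\mathcal{P}_2}R_2(\mathbb{P})$. *)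

(* Defs.v *)
From HB Require Import structures.
From mathcomp Require Import all_boot all_order all_algebra.
From mathcomp Require Import all_classical all_reals all_analysis.
Set Implicit Arguments. Unset Strict Implicit. Unset Printing Implicit Defensive.
Import Order.TTheory GRing.Theory Num.Theory.
Local Open Scope classical_set_scope.
Local Open Scope ring_scope.

(* Machines and tasks are indexed by 'I_2 (index 0 = machine/task 1,
   index 1 = machine/task 2).  An allocation X in {0,1}^{2x2} with
   X_1j + X_2j = 1 is encoded as the map a : task -> machine. *)
Section Sched.
Variable R : realType.

Definition alloc := {ffun 'I_2 -> 'I_2}.

Definition load (a : alloc) (T : 'M[R]_2) (i : 'I_2) : R :=
  \sum_(j < 2 | a j == i) T i j.

Definition makespan (a : alloc) (T : 'M[R]_2) : R :=
  Num.max (load a T 0) (load a T 1).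

Definition opt_makespan (T : 'M[R]_2) : R :=
  \big[Num.min/makespan [ffun j => 0] T]_(a : alloc) makespan a T.

Definition pos_matrices : set 'M[R]_2 := [set T | forall i j, 0 < T i j].

Definition zcoord (z : R * R) (j : 'I_2) : R := if j == 0 then z.1 else z.2.

Definition alg_alloc (z : R * R) (T : 'M[R]_2) : alloc :=
  [ffun j => if T 0 j / T 1 j < zcoord z j then 0 else 1].

Definition P2 : set (probability (R * R)%type R) :=
  [set P | P [set z : R * R | 0 < z.1 /\ 0 < z.2] = 1%E].

Definition exp_makespan (P : probability (R * R)%type R) (T : 'M[R]_2) : \bar R :=
  (\int[P]_(z in setT) (makespan (alg_alloc z T) T)%:E)%E.

Definition ratio2 (P : probability (R * R)%type R) : \bar R :=
  ereal_sup [set (exp_makespan P T * ((opt_makespan T)^-1)%:E)%E | T in pos_matrices].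

Definition R2 : \bar R := ereal_inf [set ratio2 P | P in P2].

Definition G1pos : set (R -> R) :=
  [set F | exists mu : probability R R,
      mu [set` `]-oo, 0]] = 0%E /\ forall x, F x = fine (mu [set` `]-oo, x]])].

Definition thm7_expr (F : R -> R) (x y : R) : R :=
  1 + y - Num.min 1 (1 - x^-1 + y) * F x - y * F y
  + Num.min (1 + x^-1) (1 + y) * Num.max 0 (F x + F y - 1).

Definition thm7_rhs : \bar R :=
  ereal_inf [set ereal_sup [set (thm7_expr F xy.1 xy.2)%:E
                           | xy in [set xy : R * R | 0 < xy.1 /\ 0 < xy.2]]
            | F in G1pos].
End Sched.

(* Main.v *)
(** Let [x], [y] be the ratios T_1j / T_2j.  Given the distribution of (z1, z2),
    the expected makespan is a nonnegative combination of the four makespans, so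
    it is monotone and sublinear in T on matrices with fixed ratios.  Every such
    T is dominated by a combination of [[1, y], [1/x, 1]] and [[x, 1], [1, 1/y]]
    of total weight M^*(T), so only these two families matter.  Their costs are
    affine in the two marginal cdfs at x, y and increasing in the joint cdf.
    For the lower bound, average the two marginals and use the Frechet bound
    H(x, y) >= max(0, F1(x) + F2(y) - 1).  For the upper bound, couple two copies
    of F antimonotonically, z = (F^-1(U), F^-1(1 - U)), where that bound is an
    equality. *)
Require Import Defs.
From HB Require Import structures.
From mathcomp Require Import all_boot all_order all_algebra.
From mathcomp Require Import all_classical all_reals all_analysis.
From mathcomp Require Import ring lra.
Set Implicit Arguments. Unset Strict Implicit. Unset Printing Implicit Defensive.
Import Order.TTheory GRing.Theory Num.Theory numFieldNormedType.Exports.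
Local Open Scope classical_set_scope.
Local Open Scope ring_scope.

(** * Two-by-two instances and the two extremal families *)

Definition alloc2 (i j : 'I_2) : alloc := [ffun k : 'I_2 => if k == 0 then i else j].

Definition mx2 (R : realType) (a b c d : R) : 'M[R]_2 :=
  \matrix_(i, j) if i == 0 then (if j == 0 then a else b)
                 else (if j == 0 then c else d).

Section Deterministic.
Variable R : realType.
Implicit Types (T : 'M[R]_2) (x y f g h : R).

Lemma ord2P (i : 'I_2) : i = 0 \/ i = 1.
Proof. by case: i => -[|[|//]] p; [left|right]; apply: val_inj. Qed.

Lemma load2E (a : alloc) T (i : 'I_2) :
  load a T i = (if a 0 == i then T i 0 else 0) + (if a 1 == i then T i 1 else 0).
Proof.
rewrite /load big_mkcond big_ord_recl big_ord1.
by have -> : lift ord0 ord0 = 1 :> 'I_2 by apply: val_inj.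
Qed.

Lemma alloc2_eta (a : alloc) : a = alloc2 (a 0) (a 1).
Proof. by apply/ffunP => k; rewrite ffunE; have [->|->] := ord2P k. Qed.

Lemma makespan00 T : pos_matrices T -> makespan (alloc2 0 0) T = T 0 0 + T 0 1.
Proof.
move=> T0; rewrite /makespan !load2E !ffunE /=.
by rewrite addr0 max_l// addr_ge0// ltW.
Qed.

Lemma makespan11 T : pos_matrices T -> makespan (alloc2 1 1) T = T 1 0 + T 1 1.
Proof.
move=> T0; rewrite /makespan !load2E !ffunE /=.
by rewrite addr0 max_r// addr_ge0// ltW.
Qed.

Lemma makespan01 T : makespan (alloc2 0 1) T = Num.max (T 0 0) (T 1 1).
Proof. by rewrite /makespan !load2E !ffunE /= addr0 add0r. Qed.

Lemma makespan10 T : makespan (alloc2 1 0) T = Num.max (T 0 1) (T 1 0).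
Proof. by rewrite /makespan !load2E !ffunE /= addr0 add0r. Qed.

Lemma opt_makespan_le T (a : alloc) : opt_makespan T <= makespan a T.
Proof. exact: bigmin_le. Qed.

Lemma opt_makespan_attained T : exists a, opt_makespan T = makespan a T.
Proof.
rewrite /opt_makespan; elim/big_ind: _ => [|u v [a ->] [b ->]|a _].
- by eexists.
- by case: (leP (makespan a T) (makespan b T)) => _; [exists a|exists b].
- by exists a.
Qed.

Lemma makespan_gt0 T (a : alloc) : pos_matrices T -> 0 < makespan a T.
Proof.
move=> T0; have := T0 0 0; have := T0 0 1; have := T0 1 0; have := T0 1 1.
rewrite (alloc2_eta a); have [->|->] := ord2P (a 0);
  have [->|->] := ord2P (a 1).
- by rewrite makespan00// => *; rewrite addr_gt0.
- by rewrite makespan01 lt_max => _ _ _ ->.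
- by rewrite makespan10 lt_max => _ _ -> _.
- by rewrite makespan11// => *; rewrite addr_gt0.
Qed.

Lemma opt_makespan_gt0 T : pos_matrices T -> 0 < opt_makespan T.
Proof. by move=> T0; have [a ->] := opt_makespan_attained T; exact: makespan_gt0. Qed.

(* Expected makespan when P(z1 <= r1) = f, P(z2 <= r2) = g and
   P(z1 <= r1, z2 <= r2) = h, where r_j = T_1j / T_2j. *)
Definition mean_makespan T (f g h : R) : R :=
  (1 - f - g + h) * (T 0 0 + T 0 1) + (g - h) * Num.max (T 0 0) (T 1 1)
  + (f - h) * Num.max (T 0 1) (T 1 0) + h * (T 1 0 + T 1 1).

(** Expected makespan on [[1, y], [1/x, 1]]. At f = F x, g = F y and h the Frechet lower bound it is
    [thm7_expr]. *)
Definition split_cost (f g h x y : R) : R :=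
  1 + y - Num.min 1 (1 - x^-1 + y) * f - y * g
  + Num.min (1 + x^-1) (1 + y) * h.

(** The two minima are 1 + y - max(y, 1/x) and that quantity plus 1/x, so comparing y with 1/x
    settles both. *)
Lemma split_costE f g h x y :
  split_cost f g h x y = (1 - f - g + h) * (1 + y) + (g - h)
    + (f - h) * Num.max y x^-1 + h * (x^-1 + 1).
Proof.
rewrite /split_cost; set s := x^-1; case: (leP y s) => ys.
- by rewrite (min_idPr _) ?(min_idPr _); [ring|lra|lra].
- by rewrite (min_idPl _) ?(min_idPl _); [ring|lra|lra].
Qed.

Lemma pos_mx2 (a b c d : R) : 0 < a -> 0 < b -> 0 < c -> 0 < d ->
  pos_matrices (mx2 a b c d).
Proof. by move=> ? ? ? ? i j; rewrite mxE; case: ifP; case: ifP. Qed.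

Lemma mean_makespan_split f g h x y :
  mean_makespan (mx2 1 y x^-1 1) f g h = split_cost f g h x y.
Proof. by rewrite split_costE /mean_makespan !mxE /= maxxx mulr1. Qed.

(** Exchanging the columns (tasks) gives [[1, x], [1/y, 1]], whence the swapped arguments. *)
Lemma mean_makespan_cross f g h x y :
  mean_makespan (mx2 x 1 1 y^-1) f g h = split_cost g f h y x.
Proof. by rewrite split_costE /mean_makespan !mxE /= maxxx mulr1; ring. Qed.

(* If T_1j = r_j T_2j, then T is dominated entrywise by a combination of
   [[1, r2], [1/r1, 1]] and [[r1, 1], [1, 1/r2]] whose total weight is the
   makespan of any given allocation. *)
Lemma mean_makespan_le T (a : alloc) f g h :
  pos_matrices T -> 0 <= h -> h <= f -> h <= g -> 0 <= 1 - f - g + h ->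
  mean_makespan T f g h <= makespan a T *
    Num.max (split_cost f g h (T 0 0 / T 1 0) (T 0 1 / T 1 1))
            (split_cost g f h (T 0 1 / T 1 1) (T 0 0 / T 1 0)).
Proof.
move=> T0 h0 hf hg fg1; set x := T 0 0 / _; set y := T 0 1 / _.
set E := Num.max _ _.
have cx : T 0 0 = x * T 1 0 by rewrite divfK// gt_eqF.
have cy : T 0 1 = y * T 1 1 by rewrite divfK// gt_eqF.
have x0 : 0 < x by rewrite divr_gt0.
have y0 : 0 < y by rewrite divr_gt0.
(* At fixed f, g, h the mean makespan is monotone and sublinear in the entries, so domination of [T]
   with weights u and v bounds it by u + v times the larger cost. *)
have key u v : 0 <= u -> 0 <= v ->
    T 0 0 <= u + v * x -> T 0 1 <= u * y + v ->
    T 1 0 <= u * x^-1 + v -> T 1 1 <= u + v * y^-1 ->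
    mean_makespan T f g h <= (u + v) * E.
  move=> u0 v0 h00 h01 h10 h11.
  have le1 : u * split_cost f g h x y <= u * E by rewrite ler_wpM2l// le_max lexx.
  have le2 : v * split_cost g f h y x <= v * E.
    by rewrite ler_wpM2l// le_max lexx orbT.
  rewrite mulrDl; apply: le_trans (lerD le1 le2).
  rewrite -mean_makespan_split -mean_makespan_cross /mean_makespan !mxE /= !maxxx.
  have s1 := ler_wpM2l fg1 (lerD h00 h01).
  have s4 := ler_wpM2l h0 (lerD h10 h11).
  have m2 : Num.max (T 0 0) (T 1 1) <= u + v * Num.max x y^-1.
    rewrite ge_max; apply/andP; split; [apply: le_trans h00 _|apply: le_trans h11 _];
    by rewrite lerD2l ler_wpM2l// le_max lexx ?orbT.
  have m3 : Num.max (T 0 1) (T 1 0) <= u * Num.max y x^-1 + v.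
    rewrite ge_max; apply/andP; split; [apply: le_trans h01 _|apply: le_trans h10 _];
    by rewrite lerD2r ler_wpM2l// le_max lexx ?orbT.
  have hf0 : 0 <= f - h by rewrite subr_ge0.
  have hg0 : 0 <= g - h by rewrite subr_ge0.
  have s2 := ler_wpM2l hg0 m2; have s3 := ler_wpM2l hf0 m3.
  move: s1 s2 s3 s4; lra.
have p00 := T0 0 0; have p01 := T0 0 1; have p10 := T0 1 0; have p11 := T0 1 1.
have xV : T 1 0 = T 0 0 * x^-1 by rewrite cx mulrAC mulfV ?mul1r// gt_eqF.
have yV : T 1 1 = T 0 1 * y^-1 by rewrite cy mulrAC mulfV ?mul1r// gt_eqF.
have xi : 0 < x^-1 by rewrite invr_gt0.
have yi : 0 < y^-1 by rewrite invr_gt0.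
have mle (u v w : R) : 0 <= u -> v <= w -> v * u <= w * u.
  by move=> ? ?; rewrite ler_wpM2r.
(* Weights (u, v) in the four cases: ([T 0 0], [T 0 1]), (max, 0), (0, max), ([T 1 1], [T 1 0]).
   Each pair sums to the makespan of [a]. *)
rewrite (alloc2_eta a); have [->|->] := ord2P (a 0); have [->|->] := ord2P (a 1).
- rewrite makespan00//; apply: key; nra.
- rewrite makespan01 -[Num.max _ _]addr0.
  have m1 : T 0 0 <= Num.max (T 0 0) (T 1 1) by rewrite le_max lexx.
  have m2 : T 1 1 <= Num.max (T 0 0) (T 1 1) by rewrite le_max lexx orbT.
  apply: key; rewrite ?mul0r ?addr0//; first exact: le_trans (ltW p00) m1.
  + by rewrite cy mulrC ler_wpM2r// ltW.
  + by rewrite xV ler_wpM2r// ltW.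
- rewrite makespan10 -[Num.max _ _]add0r.
  have m1 : T 0 1 <= Num.max (T 0 1) (T 1 0) by rewrite le_max lexx.
  have m2 : T 1 0 <= Num.max (T 0 1) (T 1 0) by rewrite le_max lexx orbT.
  apply: key; rewrite ?mul0r ?add0r//; first exact: le_trans (ltW p01) m1.
  + by rewrite cx mulrC ler_wpM2r// ltW.
  + by rewrite yV ler_wpM2r// ltW.
- rewrite makespan11// addrC; apply: key; nra.
Qed.

Lemma opt_makespan_split_le1 x y : opt_makespan (mx2 1 y x^-1 1) <= 1.
Proof.
by apply: le_trans (opt_makespan_le _ (alloc2 0 1)) _; rewrite makespan01 !mxE /= maxxx.
Qed.

Lemma opt_makespan_cross_le1 x y : opt_makespan (mx2 x 1 1 y^-1) <= 1.
Proof.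
by apply: le_trans (opt_makespan_le _ (alloc2 1 0)) _; rewrite makespan10 !mxE /= maxxx.
Qed.

Lemma split_cost_ge0 f g h x y : 0 < x -> 0 < y ->
  0 <= h -> h <= f -> h <= g -> 0 <= 1 - f - g + h -> 0 <= split_cost f g h x y.
Proof.
move=> x0 y0 h0 hf hg fg; rewrite split_costE.
have xi : 0 < x^-1 by rewrite invr_gt0.
have m0 : 0 <= Num.max y x^-1 by rewrite le_max (ltW y0).
have := mulr_ge0 fg (ltW y0); have := mulr_ge0 h0 (ltW xi).
have hf0 : 0 <= f - h by rewrite subr_ge0.
by have := mulr_ge0 hf0 m0; lra.
Qed.

(* Frechet bound, averaged over the two tasks. *)
Lemma split_cost_mix_le f1 f2 g1 g2 h k x y : 0 < x -> 0 < y ->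
  0 <= h -> 0 <= k -> f1 + g2 - 1 <= h -> f2 + g1 - 1 <= k ->
  split_cost (2^-1 * (f1 + f2)) (2^-1 * (g1 + g2))
    (Num.max 0 (2^-1 * (f1 + f2) + 2^-1 * (g1 + g2) - 1)) x y <=
  Num.max (split_cost f1 g2 h x y) (split_cost f2 g1 k x y).
Proof.
move=> x0 y0 h0 k0 hh kk.
set w := Num.max 0 _.
(* The nontrivial argument of the maximum is half the sum of the two Frechet lower bounds. *)
have wle : w <= 2^-1 * (h + k).
  by rewrite /w ge_max; apply/andP; split; lra.
set c := Num.min (1 + x^-1) (1 + y).
have c0 : 0 <= c.
  have xi : 0 < x^-1 by rewrite invr_gt0.
  by rewrite /c le_min; apply/andP; split; rewrite addr_ge0// ltW.
(* The cost is affine in f, g, h with coefficient [c] >= 0 on h, so the averaged data cost at most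
   the average of the two costs. *)
apply: (@le_trans _ _ (2^-1 * (split_cost f1 g2 h x y + split_cost f2 g1 k x y))).
  rewrite /split_cost -/c; have := ler_wpM2l c0 wle.
  by set m := Num.min _ _; lra.
have : split_cost f1 g2 h x y <=
    Num.max (split_cost f1 g2 h x y) (split_cost f2 g1 k x y).
  by rewrite le_max lexx.
have : split_cost f2 g1 k x y <=
    Num.max (split_cost f1 g2 h x y) (split_cost f2 g1 k x y).
  by rewrite le_max lexx orbT.
lra.
Qed.

End Deterministic.

(** * Joint and marginal cdfs, and the expected makespan *)

Section Measure.
Variable R : realType.
Implicit Types (P : probability (R * R)%type R) (x y : R).

Definition joint_cdf P (x y : R) : R := fine (P [set z | z.1 <= x /\ z.2 <= y]).
Definition cdf1 P (x : R) : R := fine (P [set z | z.1 <= x]).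
Definition cdf2 P (x : R) : R := fine (P [set z | z.2 <= x]).

Lemma measurable_fst_le (x : R) : measurable [set z : R * R | z.1 <= x].
Proof.
rewrite (_ : mkset _ = setT `&` fst @^-1` `]-oo, x]).
  by apply: measurable_fst => //; exact: measurable_itv.
by apply/seteqP; split => z /=; rewrite in_itv //= => -[].
Qed.

Lemma measurable_snd_le (x : R) : measurable [set z : R * R | z.2 <= x].
Proof.
rewrite (_ : mkset _ = setT `&` snd @^-1` `]-oo, x]).
  by apply: measurable_snd => //; exact: measurable_itv.
by apply/seteqP; split => z /=; rewrite in_itv //= => -[].
Qed.

Lemma measurable_positive_quadrant :
  measurable [set z : R * R | 0 < z.1 /\ 0 < z.2].
Proof.
rewrite (_ : mkset _ = ~` ([set z | z.1 <= 0] `|` [set z | z.2 <= 0])).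
  apply: measurableC; apply: measurableU;
    [exact: measurable_fst_le|exact: measurable_snd_le].
by rewrite setCU; apply/seteqP; split => z /=; rewrite !ltNge => -[/negP ? /negP ?].
Qed.

(** These make the four weights in [mean_makespan] nonnegative; the last one is 1 - P(A or B), by
    inclusion-exclusion. *)
Lemma joint_cdf_bounds P x y :
  [/\ 0 <= joint_cdf P x y, joint_cdf P x y <= cdf1 P x,
      joint_cdf P x y <= cdf2 P y &
      0 <= 1 - cdf1 P x - cdf2 P y + joint_cdf P x y].
Proof.
have mA := measurable_fst_le x; have mB := measurable_snd_le y.
have mC := measurableI _ _ mA mB.
rewrite /joint_cdf /cdf1 /cdf2; split.
- exact: fine_ge0.
- by rewrite fine_le ?fin_num_measure// le_measure ?inE//; exact: subIsetl.
- by rewrite fine_le ?fin_num_measure// le_measure ?inE//; exact: subIsetr.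
- suff : ((fine (P [set z | z.1 <= x]) + fine (P [set z | z.2 <= y])
      - fine (P ([set z | z.1 <= x] `&` [set z | z.2 <= y])))%:E <= 1)%E.
    by rewrite !lee_fin /setI; set a := fine _; set b := fine _; set c := fine _; lra.
  rewrite EFinB EFinD !fineK ?fin_num_measure//.
  apply: le_trans (probability_le1 P (measurableU _ _ mA mB)).
  by rewrite measureUfinl// ltey_eq fin_num_measure.
Qed.

Lemma exp_makespanE P (T : 'M[R]_2) : pos_matrices T ->
  exp_makespan P T =
  (mean_makespan T (cdf1 P (T 0 0 / T 1 0)) (cdf2 P (T 0 1 / T 1 1))
     (joint_cdf P (T 0 0 / T 1 0) (T 0 1 / T 1 1)))%:E.
Proof.
move=> T0; set x := T 0 0 / _; set y := T 0 1 / _.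
set A := [set z : R * R | z.1 <= x]; set B := [set z : R * R | z.2 <= y].
have mA : measurable A by exact: measurable_fst_le.
have mB : measurable B by exact: measurable_snd_le.
have mC : measurable (A `&` B) by exact: measurableI.
(* The makespan is a step function of z. The rule is strict, so z_j <= r_j sends task j to the
   second machine. [c] is the value off A and B, [d1] and [d2] the change from moving one task, [d3]
   the interaction. *)
pose c := T 0 0 + T 0 1.
pose d1 := Num.max (T 0 1) (T 1 0) - c.
pose d2 := Num.max (T 0 0) (T 1 1) - c.
pose d3 := T 1 0 + T 1 1 - c - d1 - d2.
rewrite /exp_makespan.
under eq_integral => z _.
  rewrite (_ : makespan _ _ = c + d1 * \1_A z + d2 * \1_B z + d3 * \1_(A `&` B) z).
    rewrite !EFinD (EFinM d1) (EFinM d2) (EFinM d3); over.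
  rewrite (alloc2_eta (alg_alloc _ _)) !ffunE /= /zcoord /= -/x -/y.
  rewrite !indicE in_setI.
  have -> : (z \in A) = (z.1 <= x) by apply/idP/idP; rewrite inE.
  have -> : (z \in B) = (z.2 <= y) by apply/idP/idP; rewrite inE.
  rewrite /d3 /d1 /d2 /c; case: ltP => _; case: ltP => _ /=;
  rewrite ?makespan00 ?makespan01 ?makespan10 ?makespan11//; ring.
have ind k (U : set (R * R)) : measurable U ->
    P.-integrable setT (fun z => (k%:E * (\1_U z)%:E)%E).
  by move=> mU; apply: integrableZl => //; exact: integrable_indic.
have ic : P.-integrable setT (fun=> c%:E) by exact: finite_measure_integrable_cst.
have int0 : (\int[P]_z c%:E)%E = c%:E.
  transitivity (c%:E * P setT)%E; first exact: integral_cst.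
  by rewrite probability_setT mule1.
have int k (U : set (R * R)) : measurable U ->
    (\int[P]_z (k%:E * (\1_U z)%:E))%E = (k * fine (P U))%:E.
  move=> mU; rewrite integralZl//; last exact: integrable_indic.
  by rewrite integral_indic// setIT EFinM fineK// fin_num_measure.
rewrite integralD//; [|by do ?[apply: integrableD => //]; exact: ind|exact: ind].
rewrite integralD//; [|by do ?[apply: integrableD => //]; exact: ind|exact: ind].
rewrite integralD//; [|exact: ind].
rewrite !int// int0 -!EFinD; congr EFin.
have -> : fine (P (A `&` B)) = joint_cdf P x y by [].
rewrite -/(cdf1 P x) -/(cdf2 P y) /mean_makespan /d3 /d1 /d2 /c; ring.
Qed.
End Measure.

(** * Pushforwards, mixtures and the uniform law *)

Section Probabilities.
Variable R : realType.

Lemma pushforward_probability d d' (T : measurableType d) (T' : measurableType d')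
    (P : probability T R) (f : T -> T') : measurable_fun setT f ->
  exists Q : probability T' R, forall A, Q A = P (f @^-1` A).
Proof.
move=> mf; pose X : {mfun T >-> T'} := mfun_Sub (mem_set mf).
by exists (distribution P X).
Qed.

Section Mixture.
Context d (T : measurableType d) (P Q : probability T R).

Definition mixture := mscale (2^-1)%:nng (measure_add P Q).

HB.instance Definition _ := Measure.on mixture.

Lemma mixtureE A : mixture A = ((2^-1)%:E * (P A + Q A))%E.
Proof. by rewrite -measure_addE. Qed.

Let mixture_setT : mixture setT = 1%E.
Proof.
rewrite mixtureE !probability_setT -EFinD -EFinM.
by congr EFin; lra.
Qed.

HB.instance Definition _ := Measure_isProbability.Build _ _ _ mixture mixture_setT.

End Mixture.

Local Notation U := (uniform_prob (@ltr01 R)).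

(** Endpoints carry no mass, so any mix of open and closed ends is allowed; the maximum covers b <
    a. *)
Lemma uniform_prob_itv (b0 b1 : bool) (a b : R) : 0 <= a -> b <= 1 ->
  U [set` Interval (BSide b0 a) (BSide b1 b)] = (Num.max 0 (b - a))%:E.
Proof.
move=> a0 b1'; rewrite /uniform_prob integral_uniform_pdf.
have sub (x : R) : x \in Interval (BSide b0 a) (BSide b1 b) -> 0 <= x <= 1.
  rewrite in_itv /= => /andP[/lteifW ax /lteifW xb].
  by rewrite (le_trans a0 ax) (le_trans xb b1').
have -> : [set` Interval (BSide b0 a) (BSide b1 b)] `&` `[0, 1]%classic =
    [set` Interval (BSide b0 a) (BSide b1 b)] :> set R.
  by apply/setIidPl => x /= /sub; rewrite in_itv.
rewrite (eq_integral (fun=> 1%E)); last first.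
  by move=> x; rewrite inE/= /uniform_pdf => /sub ->; rewrite subr0 invr1.
rewrite integral_cst//= mul1e lebesgue_measure_itv/= lte_fin.
by case: ltP => ab; rewrite -?EFinB; congr EFin; [rewrite max_r|rewrite max_l];
  rewrite ?subr_ge0 ?subr_le0// ltW.
Qed.

(** The complement of []0, 1[] is null. This lets events be compared only where the quantile inverts
    the cdf. *)
Lemma uniform_prob_eq (A B : set R) : measurable A -> measurable B ->
  (forall u, 0 < u -> u < 1 -> A u <-> B u) -> U A = U B.
Proof.
move=> mA mB AB.
pose I : set R := `]0, 1[%classic.
have mI : measurable I by exact: measurable_itv.
have U0 : U (~` I) = 0%E.
  transitivity (1 - U I)%E; first exact: probability_setC.
  by rewrite /I uniform_prob_itv// subr0 max_r// -EFinB subrr.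
have restr (C : set R) : measurable C -> U C = U (C `&` I).
  move=> mC; transitivity (U (C `\` I) + U (C `&` I))%E.
    exact: measureDI.
  suff -> : U (C `\` I) = 0%E by rewrite add0e.
  apply/eqP; rewrite -measure_le0 -U0 le_measure ?inE//.
  - exact: measurableD.
  - exact: measurableC.
rewrite restr// [RHS]restr//; congr (U _); apply/seteqP.
by split => u [Cu Iu]; split => //; move: Iu Cu; rewrite /I /= in_itv /=;
  move=> /andP[u0 u1]; have [] := AB u u0 u1.
Qed.

(** * The quantile function of a law on the positive reals *)

Section Quantile.
Variable mu : probability R R.
Hypothesis mu0 : mu [set` `]-oo, 0]] = 0%E.

Definition cdf_of (x : R) : R := fine (mu [set` `]-oo, x]]).
Local Notation F := cdf_of.

(** The identity as a random variable with law [mu], giving access to the limit theorems on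
    [cdf]. *)
Let X : {mfun R >-> R} := mfun_Sub (mem_set (@measurable_id _ R setT)).

Lemma cdf_of_right_continuous : right_continuous F.
Proof.
move=> x; have := @cdf_right_continuous _ _ _ mu X x.
have -> : cdf (P := mu) X x = (F x)%:E by rewrite /F fineK ?fin_num_measure.
by move/fine_cvg.
Qed.

Lemma cdf_of_cvgy : F x @[x --> +oo%R] --> (1 : R).
Proof. by have /fine_cvg := @cvg_cdfy1 _ _ _ mu X. Qed.

Lemma cdf_of_homo : {homo F : x y / x <= y}.
Proof.
move=> x y xy; rewrite fine_le ?fin_num_measure// le_measure ?inE//.
exact: subset_itvl.
Qed.

Lemma cdf_of_ge0 x : 0 <= F x.
Proof. exact: fine_ge0. Qed.

Lemma cdf_of_le1 x : F x <= 1.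
Proof. by rewrite -lee_fin fineK ?fin_num_measure// probability_le1. Qed.

Lemma cdf_of_le0 x : x <= 0 -> F x = 0.
Proof.
by move=> /cdf_of_homo h; apply/eqP; rewrite eq_le cdf_of_ge0 andbT (le_trans h)// /F mu0.
Qed.

(** Generalised inverse of [F], with default value 1 off []0, 1[]. *)
Definition quantile (u : R) : R :=
  if 0 < u < 1 then inf [set x | u <= F x] else 1.

(** Galois connection: the set is nonempty since u < 1, bounded below by 0 since u > 0, and contains
    its infimum by right continuity. *)
Lemma quantile_le u x : 0 < u -> u < 1 -> (quantile u <= x) = (u <= F x).
Proof.
move=> u0 u1; rewrite /quantile u0 u1 /=; set S := [set x | u <= F x].
have S0 : S !=set0.
  have [y Fy] := filter_ex (cvgr_ge _ cdf_of_cvgy _ u1); by exists y.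
have lS : has_lbound S.
  exists 0 => y Sy; rewrite leNgt; apply/negP => /ltW/cdf_of_le0 Fy.
  by move: Sy; rewrite /S /= Fy leNgt u0.
apply/idP/idP => [qx|Sx]; last exact: ge_inf.
apply: le_trans (cdf_of_homo qx); rewrite leNgt; apply/negP => Fu.
(* If F(inf S) < u, some y > inf S still has F y < u, yet an element of [S] lies below y. *)
near (inf S)^'+ => y.
have yS : inf S < y by near: y; exact: nbhs_right_gt.
have Fyu : F y < u by near: y; apply: cvgr_lt Fu; exact: cdf_of_right_continuous.
have [z Sz zy] := inf_lt S0 yS.
by move: Fyu; rewrite ltNge (le_trans Sz)// cdf_of_homo// ltW.
Unshelve. all: by end_near. Qed.

Lemma measurable_quantile : measurable_fun setT quantile.
Proof.
apply: (measurability _ (measurable_realfun.RGenOInfty.measurableE R)) => //.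
move=> /= _ [_ [x ->] <-]; rewrite setTI.
(* Inside []0, 1[] the condition is F x < u; outside, the default 1 satisfies it always or never. *)
have -> : quantile @^-1` `]x, +oo[%classic =
    (`]F x, +oo[%classic `&` `]0, 1[%classic) `|`
    ((if 1 <= x then set0 else setT) `&` ~` `]0, 1[%classic).
  apply/seteqP; split => u /=; rewrite !in_itv /= ?andbT.
    case: (boolP (0 < u < 1)) => [u01|u01].
      have [u0 u1] := andP u01.
      by rewrite ltNge quantile_le// -ltNge => Fu; left.
    rewrite /quantile (negbTE u01) => x1; right; split; last exact/negP.
    by rewrite leNgt x1.
  move=> [[Fu u01]|[]].
    by have [u0 u1] := andP u01; rewrite ltNge quantile_le// -ltNge.
  move=> h /negP u01; rewrite /quantile (negbTE u01).
  by move: h; case: ifPn => //; rewrite -ltNge.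
apply: measurableU; apply: measurableI; try exact: measurable_itv.
  by case: ifP.
by apply: measurableC; exact: measurable_itv.
Qed.

Lemma quantile_gt0 u : 0 < u -> u < 1 -> 0 < quantile u.
Proof. by move=> u0 u1; rewrite ltNge quantile_le// cdf_of_le0// -ltNge. Qed.

End Quantile.
End Probabilities.

(** * Reduction of the ratio to the two families, and the two constructions *)

Section Coupling.
Variable R : realType.
Implicit Types (P : probability (R * R)%type R) (x y : R).

(** [mean_makespan_le] at an optimal allocation makes the total weight the optimum itself. The
    second hypothesis, with x and y exchanged, handles the cross family. *)
Lemma ratio2_le P (M : \bar R) :
  (forall x y, 0 < x -> 0 < y ->
     ((split_cost (cdf1 P x) (cdf2 P y) (joint_cdf P x y) x y)%:E <= M)%E) ->
  (forall x y, 0 < x -> 0 < y ->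
     ((split_cost (cdf2 P x) (cdf1 P y) (joint_cdf P y x) x y)%:E <= M)%E) ->
  (ratio2 P <= M)%E.
Proof.
move=> h1 h2; apply: ge_ereal_sup => _ [T T0 <-].
rewrite exp_makespanE// -EFinM.
have x0 : 0 < T 0 0 / T 1 0 by rewrite divr_gt0.
have y0 : 0 < T 0 1 / T 1 1 by rewrite divr_gt0.
set x := T 0 0 / _ in x0 *; set y := T 0 1 / _ in y0 *.
have [b0 b1 b2 b3] := joint_cdf_bounds P x y.
have [a ea] := opt_makespan_attained T.
have := mean_makespan_le a T0 b0 b1 b2 b3.
rewrite -ea -/x -/y mulrC -ler_pdivrMr ?opt_makespan_gt0//.
rewrite -lee_fin => /le_trans; apply.
by rewrite /Num.max; case: ifP => _; [exact: h2|exact: h1].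
Qed.

(** Dividing a nonnegative cost by an optimum at most 1 cannot decrease it. *)
Lemma ratio2_ge P (T : 'M[R]_2) : pos_matrices T -> opt_makespan T <= 1 ->
  let x := T 0 0 / T 1 0 in let y := T 0 1 / T 1 1 in
  let c := mean_makespan T (cdf1 P x) (cdf2 P y) (joint_cdf P x y) in
  0 <= c -> (c%:E <= ratio2 P)%E.
Proof.
move=> T0 o1 x y c c0; apply: le_ereal_sup_tmp.
exists (exp_makespan P T * ((opt_makespan T)^-1)%:E)%E; first by exists T.
rewrite exp_makespanE// -/x -/y -/c -EFinM lee_fin ler_peMr//.
by rewrite invf_ge1// opt_makespan_gt0.
Qed.

Lemma split_le_ratio2 P x y : 0 < x -> 0 < y ->
  ((split_cost (cdf1 P x) (cdf2 P y) (joint_cdf P x y) x y)%:E <= ratio2 P)%E.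
Proof.
move=> x0 y0; have [b0 b1 b2 b3] := joint_cdf_bounds P x y.
have T0 : pos_matrices (mx2 1 y x^-1 1) by apply: pos_mx2; rewrite ?invr_gt0.
have := @ratio2_ge P _ T0 (opt_makespan_split_le1 x y).
rewrite /= !mxE /= invrK mul1r divr1 mean_makespan_split; apply.
exact: split_cost_ge0.
Qed.

(** The test instance [[y, 1], [1, 1/x]] has ratio y on the first task and x on the second. *)
Lemma cross_le_ratio2 P x y : 0 < x -> 0 < y ->
  ((split_cost (cdf2 P x) (cdf1 P y) (joint_cdf P y x) x y)%:E <= ratio2 P)%E.
Proof.
move=> x0 y0; have [b0 b1 b2 b3] := joint_cdf_bounds P y x.
have T0 : pos_matrices (mx2 y 1 1 x^-1) by apply: pos_mx2; rewrite ?invr_gt0.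
have := @ratio2_ge P _ T0 (opt_makespan_cross_le1 y x).
rewrite /= !mxE /= invrK mul1r divr1 mean_makespan_cross; apply.
by apply: split_cost_ge0 => //; move: b3; lra.
Qed.

Lemma thm7_exprE (F : R -> R) x y :
  thm7_expr F x y = split_cost (F x) (F y) (Num.max 0 (F x + F y - 1)) x y.
Proof. by []. Qed.

(** The witness is the law of z_1 or z_2 chosen by a fair coin. *)
Lemma average_cdf P : P2 P ->
  exists2 F, G1pos F & forall x, F x = 2^-1 * (cdf1 P x + cdf2 P x).
Proof.
move=> P0.
have [m1 m1E] := pushforward_probability P measurable_fst.
have [m2 m2E] := pushforward_probability P measurable_snd.
have mE (x : R) : mixture m1 m2 [set` `]-oo, x]] = (2^-1 * (cdf1 P x + cdf2 P x))%:E.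
  have e1 : (cdf1 P x)%:E = P [set z | z.1 <= x].
    by rewrite fineK// fin_num_measure//; exact: measurable_fst_le.
  have e2 : (cdf2 P x)%:E = P [set z | z.2 <= x].
    by rewrite fineK// fin_num_measure//; exact: measurable_snd_le.
  rewrite mixtureE m1E m2E EFinM EFinD e1 e2.
  congr (_ * (P _ + P _))%E; apply/seteqP; split => z /=; rewrite in_itv //=.
exists (fun x => 2^-1 * (cdf1 P x + cdf2 P x)) => //.
exists (mixture m1 m2); split; last by move=> x; exact: esym (congr1 fine (mE x)).
(* Sets missing the open positive quadrant are null, so both marginal cdfs vanish at 0. *)
have neg0 (A : set (R * R)) : measurable A ->
    A `<=` ~` [set z | 0 < z.1 /\ 0 < z.2] -> fine (P A) = 0.
  move=> mA sA; have mD := @measurable_positive_quadrant R.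
  suff -> : P A = 0%E by [].
  apply/eqP; rewrite -measure_le0.
  have <- : P (~` [set z : R * R | 0 < z.1 /\ 0 < z.2]) = 0%E.
    by rewrite probability_setC// P0 subee.
  by rewrite le_measure ?inE//; exact: measurableC.
apply: etrans (mE 0) _; rewrite /cdf1 /cdf2 !neg0 ?addr0 ?mulr0//.
- exact: measurable_snd_le.
- by move=> z /= z2 [_]; rewrite ltNge z2.
- exact: measurable_fst_le.
- by move=> z /= z1 []; rewrite ltNge z1.
Qed.

(** With z = (q u, q (1 - u)), z_1 <= x means u <= F x and z_2 <= y means u >= 1 - F y; jointly, u
    lies in an interval of length F x + F y - 1, or an empty one. *)
Lemma antimonotone_coupling (F : R -> R) : G1pos F ->
  exists2 P, P2 P & forall x y, 0 < x -> 0 < y ->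
    [/\ cdf1 P x = F x, cdf2 P y = F y &
        joint_cdf P x y = Num.max 0 (F x + F y - 1)].
Proof.
move=> [mu [mu0 FE]].
have {FE} -> : F = cdf_of mu by apply/funext => x; rewrite FE.
pose q := quantile mu.
have mq : measurable_fun setT q by exact: measurable_quantile.
have mr : measurable_fun setT (fun u : R => q (1 - u)).
  by apply: measurableT_comp => //; exact: measurable_realfun.measurable_funB.
have [P PE] := pushforward_probability (uniform_prob (@ltr01 R))
  (measurable_fun_pair mq mr).
(* Translates events on z into events on the uniform variable u. *)
have PU (A : set (R * R)) (B : set R) : measurable A -> measurable B ->
    (forall u, 0 < u -> u < 1 -> A (q u, q (1 - u)) <-> B u) ->
    P A = uniform_prob (@ltr01 R) B.
  move=> mA mB AB; rewrite PE; apply: uniform_prob_eq => //.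
  rewrite -[X in measurable X]setTI.
  exact: (measurable_fun_pair mq mr).
have u1 (u : R) : 0 < u -> u < 1 -> 0 < 1 - u /\ 1 - u < 1.
  by move=> *; split; lra.
exists P.
  rewrite /P2 /= (PU _ setT)//; first exact: probability_setT.
    exact: measurable_positive_quadrant.
  move=> u u0 ul; have [v0 v1] := u1 _ u0 ul; split => // _ /=.
  by split; exact: quantile_gt0.
move=> x y x0 y0; have Fx := cdf_of_ge0 mu x; have Fy := cdf_of_ge0 mu y.
have Fx1 := cdf_of_le1 mu x; have Fy1 := cdf_of_le1 mu y.
split.
- rewrite /cdf1 (PU _ `[0, cdf_of mu x]%classic).
  + by rewrite uniform_prob_itv//= subr0 max_r.
  + exact: measurable_fst_le.
  + exact: measurable_itv.
  + by move=> u u0 ul; rewrite /= in_itv /= (ltW u0) quantile_le.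
- rewrite /cdf2 (PU _ `[1 - cdf_of mu y, 1]%classic).
  + by rewrite uniform_prob_itv//= ?subr_ge0// subKr max_r.
  + exact: measurable_snd_le.
  + exact: measurable_itv.
  + move=> u u0 ul; have [v0 v1] := u1 _ u0 ul.
    by rewrite /= in_itv /= (ltW ul) andbT quantile_le// lerBlDl lerBlDr.
- rewrite /joint_cdf (PU _ `[1 - cdf_of mu y, cdf_of mu x]%classic).
  + rewrite uniform_prob_itv//= ?subr_ge0//; congr Num.max; lra.
  + by apply: measurableI; [exact: measurable_fst_le|exact: measurable_snd_le].
  + exact: measurable_itv.
  + move=> u u0 ul; have [v0 v1] := u1 _ u0 ul.
    rewrite /= in_itv /= !quantile_le// lerBlDl lerBlDr andbC.
    by split => [[-> ->]|/andP[-> ->]].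
Qed.

End Coupling.

(** * The two inequalities between the infima *)

Unset Implicit Arguments.

Theorem theorem7 (R : realType) : R2 R = thm7_rhs R.
Proof.
apply/eqP; rewrite eq_le; apply/andP; split.
- apply: le_ereal_inf_tmp => _ [F GF <-].
  have [P P0 PE] := antimonotone_coupling GF.
  apply: ge_ereal_inf; exists (ratio2 P); first by exists P.
  apply: ratio2_le => x y x0 y0.
  + have [-> -> ->] := PE _ _ x0 y0; rewrite -thm7_exprE.
    by apply: ereal_sup_ubound; exists (x, y).
  (* Equal marginals and the symmetry of the Frechet value give the same expression for the cross
     family. *)
  + have [-> -> ->] := PE _ _ y0 x0; rewrite [F y + _]addrC -thm7_exprE.
    by apply: ereal_sup_ubound; exists (x, y).
- apply: le_ereal_inf_tmp => _ [P P0 <-].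
  have [F GF FE] := average_cdf P0.
  apply: ge_ereal_inf; eexists; first by exists F.
  apply: ge_ereal_sup => _ [[x y] /= [x0 y0] <-].
  have [b0 b1 b2 b3] := joint_cdf_bounds P x y.
  have [c0 c1 c2 c3] := joint_cdf_bounds P y x.
  rewrite thm7_exprE !FE.
  (* The union bounds are the Frechet inequalities that the averaging argument takes as input. *)
  have : cdf1 P x + cdf2 P y - 1 <= joint_cdf P x y by lra.
  have : cdf2 P x + cdf1 P y - 1 <= joint_cdf P y x by lra.
  move=> k h; have := split_cost_mix_le x0 y0 b0 c0 h k.
  rewrite -lee_fin => /le_trans; apply.
  by rewrite /Num.max; case: ifP => _; [exact: cross_le_ratio2|exact: split_le_ratio2].
Qed.
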